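(* Let $$\gamma(p)=\frac{\alpha\lambda^2(1-p)}{2n^2p}+\max\left\{\frac{L_f}{1-p},\ \frac{\lambda}{n}\left(1+\frac{4(1-p)}{p}\right)\right\},\qquad p\in(0,1),$$ let $C(p):=p(1-p)\gamma(p)$ and $L:=nL_f$. The probability $p^*$ optimizing (i.e. minimizing over $p\in(0,1)$) $C$ is equal to $\max\{p_e,p_A\}$, where $$p_e=\frac{7\lambda+L-\sqrt{\lambda^2+14\lambda L+L^2}}{6\lambda}\qquad\text{and}\qquad p_A=1-\frac{Ln}{\alpha\lambda^2}.$$
   Context: $n\ge1$ is an integer (number of devices), $\lambda>0$ is the penalty parameter, $L_f>0$ and $\mu>0$ are the smoothness and strong convexity constants of a function $f$, and $\alpha=\frac{4\left(4\omega+4\omega_M(1+\omega)\right)}{\mu}$, where $\omega=\max_i\omega_i>0$ and $\omega_M\ge0$ are variance constants of compression operators; in particular $\alpha>0$ and $\alpha$ does not depend on $p$. The number $p_A$ may be negative. *)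

(* Defs.v *)
From HB Require Import structures.
From mathcomp Require Import all_boot all_order all_algebra.
From mathcomp Require Import reals.
Set Implicit Arguments.
Unset Strict Implicit.
Unset Printing Implicit Defensive.
Import Order.TTheory GRing.Theory Num.Theory.
Local Open Scope ring_scope.

Section Definitions.
Variable R : realType.

(* The default value 0 is harmless: whenever this quantity is positive, it is
   the maximum of the family. *)
Definition max_variance (n : nat) (omega_ : 'I_n -> R) : R :=
  \big[Num.max/0]_(i < n) omega_ i.

Definition alpha (mu omega omegaM : R) : R :=
  4 * (4 * omega + 4 * omegaM * (1 + omega)) / mu.

Definition gamma (n : nat) (a lambda Lf p : R) : R :=
  a * lambda ^+ 2 * (1 - p) / (2 * n%:R ^+ 2 * p) +
  Num.max (Lf / (1 - p)) (lambda / n%:R * (1 + 4 * (1 - p) / p)).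

Definition C (n : nat) (a lambda Lf p : R) : R :=
  p * (1 - p) * gamma n a lambda Lf p.

Definition p_e (lambda L : R) : R :=
  (7 * lambda + L - Num.sqrt (lambda ^+ 2 + 14 * lambda * L + L ^+ 2)) /
  (6 * lambda).

Definition p_A (n : nat) (a lambda L : R) : R :=
  1 - L * n%:R / (a * lambda ^+ 2).

Definition minimizes_on01 (F : R -> R) (p : R) : Prop :=
  0 < p < 1 /\ forall q : R, 0 < q < 1 -> F p <= F q.

End Definitions.

(* Main.v *)
(** On (0,1), C(p) = A(1-p)^2 + max(Lf p, (lambda/n)(1-p)(4-3p)) with
    A = alpha lambda^2/(2n^2).  The number p_e is the smaller root of
    3 lambda p^2 - (7 lambda + L) p + 4 lambda, at which the two branches of the
    maximum cross.  To the left of p_e the quadratic branch is active and C is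
    strictly decreasing; to the right C is the parabola A(1-p)^2 + Lf p, whose
    vertex is p_A < 1.  Hence max(p_e, p_A) is the strict minimizer. *)
Require Import Defs.
From HB Require Import structures.
From mathcomp Require Import all_boot all_order all_algebra.
From mathcomp Require Import reals.
From mathcomp Require Import ring lra.
Set Implicit Arguments.
Unset Strict Implicit.
Unset Printing Implicit Defensive.
Import Order.TTheory GRing.Theory Num.Theory.
Local Open Scope ring_scope.

Lemma minimizes_on01_strict (R : realType) (F : R -> R) (m p : R) :
  0 < m < 1 -> (forall q, 0 < q < 1 -> q != m -> F m < F q) ->
  minimizes_on01 F p <-> p = m.
Proof.
move=> m01 Fm; split=> [[p01 minp]|->].
  apply/eqP/negP => /negP pm; have := Fm p p01 pm.
  by rewrite ltNge minp.
by split=> // q q01; have [->//|qm] := eqVneq q m; exact/ltW/Fm.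
Qed.

Section Minimizer.
Context (R : realType).
Implicit Types (lambda L a Lf p q : R).

Lemma p_e_root lambda L : 0 < lambda -> 0 < L ->
  L * p_e lambda L = lambda * ((1 - p_e lambda L) * (4 - 3 * p_e lambda L)).
Proof.
move=> l0 L0; rewrite /p_e; set s := Num.sqrt _.
have s2 : s ^+ 2 = lambda ^+ 2 + 14 * lambda * L + L ^+ 2.
  by rewrite sqr_sqrtr //; nra.
set r := _ / _; have rE : s = 7 * lambda + L - 6 * lambda * r.
  by rewrite /r; field; lra.
move: s2; rewrite rE => s2.
(* Expanded, [s2] is [12 * lambda] times the quadratic equation for [r]. *)
have lN0 : 12 * lambda != 0 by lra.
apply: (mulfI lN0); lra.
Qed.

Lemma p_e_gt0_lt1 lambda L : 0 < lambda -> 0 < L -> 0 < p_e lambda L < 1.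
Proof.
move=> l0 L0; rewrite /p_e; set s := Num.sqrt _.
have s2 : s ^+ 2 = lambda ^+ 2 + 14 * lambda * L + L ^+ 2.
  by rewrite sqr_sqrtr //; nra.
have s0 : 0 <= s by exact: sqrtr_ge0.
rewrite divr_gt0 ?ltr_pdivrMr /=; [|lra| |lra]; last first.
  (* The squares of [7 * lambda + L] and [s] differ by [48 * lambda ^+ 2]. *)
  by rewrite subr_gt0 -ltr_sqr ?nnegrE; nra.
(* Here the squares differ by [12 * lambda * L]. *)
suff : lambda + L < s by lra.
by rewrite -ltr_sqr ?nnegrE; nra.
Qed.

Lemma C_in01E n a lambda Lf q : (0 < n)%N -> 0 < q < 1 ->
  C n a lambda Lf q = a * lambda ^+ 2 / (2 * n%:R ^+ 2) * (1 - q) ^+ 2 +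
    Num.max (Lf * q) (lambda / n%:R * ((1 - q) * (4 - 3 * q))).
Proof.
move=> n0 /andP[q0 q1]; have nN0 : n%:R != 0 :> R by rewrite pnatr_eq0 -lt0n.
rewrite /C /gamma mulrDr maxr_pMr; last by nra.
by congr (_ + Num.max _ _); field; rewrite ?nN0 /=; lra.
Qed.

(** The maximum is computed exactly only at [m]; at [q] it is bounded below by whichever branch
    suffices. *)
Lemma C_max_lt n a lambda Lf q (m := Num.max (p_e lambda (n%:R * Lf))
                                      (p_A n a lambda (n%:R * Lf))) :
  (0 < n)%N -> 0 < a -> 0 < lambda -> 0 < Lf -> 0 < m < 1 ->
  0 < q < 1 -> q != m -> C n a lambda Lf m < C n a lambda Lf q.
Proof.
move=> n_gt0 a0 l0 Lf0 m01 q01 qm; rewrite !C_in01E //.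
have n0 : 0 < n%:R :> R by rewrite ltr0n.
have L0 : 0 < n%:R * Lf by exact: mulr_gt0.
set A := a * _ / _; set k := lambda / _.
have A0 : 0 < A by rewrite /A !(divr_gt0, mulr_gt0, exprn_gt0).
have k0 : 0 < k by rewrite divr_gt0.
(* The derivative of the parabola vanishes at [p_A]. *)
have LfE : Lf = 2 * A * (1 - p_A n a lambda (n%:R * Lf)).
  by rewrite /A /p_A; field; lra.
have eE : Lf * p_e lambda (n%:R * Lf)
    = k * ((1 - p_e lambda (n%:R * Lf)) * (4 - 3 * p_e lambda (n%:R * Lf))).
  have nN0 : n%:R != 0 :> R by lra.
  apply: (mulfI nN0); rewrite mulrA p_e_root // /k; field; lra.
have e01 := p_e_gt0_lt1 l0 L0.
have Eem : p_e lambda (n%:R * Lf) <= m by rewrite le_max lexx.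
have EAm : p_A n a lambda (n%:R * Lf) <= m by rewrite le_max lexx orbT.
have mE : m = p_e lambda (n%:R * Lf) \/ m = p_A n a lambda (n%:R * Lf).
  by rewrite /m; case: leP => _; [right|left].
move: m mE qm m01 Eem EAm LfE eE e01 => m.
move: (p_e _ _) (p_A _ _ _ _) => e v mE qm m01 em vm LfE eE e01.
case/andP: m01 q01 e01 => m0 m1 /andP[q0 q1] /andP[e0 e1].
(* The branches agree at [e <= m]; from there the linear one grows while the quadratic one decreases
   up to 1. *)
have -> : Num.max (Lf * m) (k * ((1 - m) * (4 - 3 * m))) = Lf * m.
  apply/max_idPl.
  have : k * ((1 - m) * (4 - 3 * m)) <= k * ((1 - e) * (4 - 3 * e)).
    by rewrite ler_pM2l //; nra.
  have : Lf * e <= Lf * m by rewrite ler_pM2l.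
  lra.
have qm2 : 0 < A * (q - m) ^+ 2.
  by rewrite mulr_gt0 // exprn_even_gt0 //= subr_eq0.
(* This product is, up to the factor [2 * A], the first-order term of the parabola at [m]. If it is
   nonnegative, the linear branch alone gives the bound. *)
have [mq|qltm] := leP 0 ((q - m) * (m - v)).
  have vertex : A * (1 - q) ^+ 2 + Lf * q - (A * (1 - m) ^+ 2 + Lf * m)
      = A * (q - m) ^+ 2 + 2 * A * ((q - m) * (m - v)) by rewrite LfE; ring.
  have : 0 <= 2 * A * ((q - m) * (m - v)) by rewrite mulr_ge0 //; lra.
  have : Lf * q <= Num.max (Lf * q) (k * ((1 - q) * (4 - 3 * q))).
    by rewrite le_max lexx.
  lra.
(* A negative product excludes [m = v], so [v < m = e] and [q] lies left of the crossing, where the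
   quadratic branch gives the bound. *)
have {}mE : m = e by case: mE => // mv; move: qltm; rewrite mv subrr mulr0 ltxx.
have {}qltm : q < m by nra.
rewrite mE eE in qltm *.
have : k * ((1 - e) * (4 - 3 * e)) < k * ((1 - q) * (4 - 3 * q)).
  by rewrite ltr_pM2l //; nra.
have : A * (1 - e) ^+ 2 < A * (1 - q) ^+ 2 by rewrite ltr_pM2l //; nra.
have : k * ((1 - q) * (4 - 3 * q))
    <= Num.max (Lf * q) (k * ((1 - q) * (4 - 3 * q))) by rewrite le_max lexx orbT.
lra.
Qed.

End Minimizer.

Theorem theorem4 (R : realType) (n : nat) (lambda Lf mu omegaM : R)
    (omega_ : 'I_n -> R)
    (n_ge1 : (1 <= n)%N) (lambda_gt0 : 0 < lambda) (Lf_gt0 : 0 < Lf)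
    (mu_gt0 : 0 < mu) (omega_gt0 : 0 < max_variance omega_)
    (omegaM_ge0 : 0 <= omegaM) :
  let a := alpha mu (max_variance omega_) omegaM in
  let L := n%:R * Lf in
  forall p : R,
    minimizes_on01 (C n a lambda Lf) p <->
    p = Num.max (p_e lambda L) (p_A n a lambda L).
Proof.
move=> a L p.
have a0 : 0 < a by rewrite /a /alpha divr_gt0 //; nra.
have n0 : 0 < n%:R :> R by rewrite ltr0n.
have L0 : 0 < L by exact: mulr_gt0.
have m01 : 0 < Num.max (p_e lambda L) (p_A n a lambda L) < 1.
  have /andP[e0 e1] := p_e_gt0_lt1 lambda_gt0 L0.
  rewrite lt_max gt_max e0 e1 /= /p_A ltrBlDr ltrDl.
  by rewrite divr_gt0 // mulr_gt0 // exprn_gt0.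
by apply: minimizes_on01_strict => // q q01 qm; exact: C_max_lt.
Qed.
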